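(* For all integers $N\ge 1$ and $j\ge 0$, \begin{align*} \tilde c(6N,j)&=c(N,j)+q^{6N}c(N-1,j-2)\,q^{2(j-2)},\\ \tilde c(6N-1,j)&=c(N,j),\\ \tilde c(6N-2,j)&=c(N,j)-q^{6N-1}c(N-1,j-1)\,q^{2(j-1)},\\ \tilde c(6N-3,j)&=q^{-2j}c(N,j)+q^{6N-4}c(N-1,j-2),\\ \tilde c(6N-4,j)&=c(N-1,j)\,q^{2j},\\ \tilde c(6N-5,j)&=q^{-2j}c(N,j)-q^{6N-3}c(N-1,j-1). \end{align*}
   Context: Let $x,q$ be commuting indeterminates. A Schur partition is a partition into positive integer parts such that any two parts differ by at least $3$ and no two consecutive multiples of $3$ (i.e. $3k$ and $3k+3$) both occur as parts; the empty partition is included. For $N\ge 1$ let $D_N(m,n)$ be the number of Schur partitions $\pi$ of $n$ with all parts $\le N$ such that (number of parts of $\pi$) + (number of even parts of $\pi$) $=m$. The Alladi-Schur polynomials are $d_N(x)=\sum_{m,n\ge 0}D_N(m,n)x^mq^n$ for $N\ge 1$, with the convention $d_{-1}(x)=d_0(x)=1$. For $n\ge 0$ let $p_n(x)=\prod_{i=1}^n(1+xq^{2i-1}+x^2q^{4i-2})$ (so $p_0(x)=1$). Let $\chi_o(n)=1$ if $n$ is odd and $0$ if $n$ is even. For $n\ge -1$ define $$\tilde d_n(x)=\frac{d_n(x)}{p_{e(n)}(x)},\qquad e(n)=\left\lceil\frac{n+3\chi_o(n)}{6}\right\rceil-\chi_o(n).$$ This quotient makes sense as a formal power series in $x$ over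 $\mathbb{Z}[q]$, since $p_{e(n)}(0)=1$; a theorem of Andrews states that $p_{e(n)}(x)$ divides $d_n(x)$. For $n\ge 1$ the coefficients $\tilde c(n,i)\in\mathbb{Z}[q]$ are defined by $\tilde d_n(x)=\sum_{i\ge 0}\tilde c(n,i)x^i$. The $c(n,i)\in\mathbb{Z}[q]$ are defined for $n\ge 0$ by $\frac{d_{6n-1}(x)}{p_n(x)}=\sum_{i=0}^n c(n,i)x^i$ (by a theorem of Andrews the left-hand side is a polynomial in $x$ of degree at most $n$); $c(0,0)=1$, and $c(n,i)=0$ if $i<0$ or $i>n$. Identities involving $q^{-2j}$ are understood in $\mathbb{Z}[q,q^{-1}]$. *)

(* Defs.v *)
From mathcomp Require Import all_boot all_order all_algebra.
From mathcomp Require Import zify lra.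

Set Implicit Arguments.
Unset Strict Implicit.
Unset Printing Implicit Defensive.

Import Order.TTheory GRing.Theory Num.Theory.
Local Open Scope ring_scope.

(* A partition is the nonincreasing sequence of its positive parts. *)
Definition is_partition (n : nat) (s : seq nat) : bool :=
  [&& sorted geq s, all (leq 1) s & sumn s == n]%N.

(* [pairwise] compares an earlier part a with a later part b, so on a
   nonincreasing sequence the truncated difference a - b is |a - b|. *)
Definition is_schur (s : seq nat) : bool :=
  pairwise (fun a b => 3 <= a - b)%N s
  && all (fun a => (3 %| a) ==> ((a + 3)%N \notin s))%N s.

Definition weight (s : seq nat) : nat :=
  (size s + count (fun a => ~~ odd a) s)%N.

(* A partition of n has at most n parts, hence the bounded sequences. *)
Definition D (N m n : nat) : nat :=
  #|[set s : n.-bseq 'I_N.+1 |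
     [&& is_partition n (map val s), is_schur (map val s)
       & weight (map val s) == m]]|.

(* Z[q][x]: the outer indeterminate is x, the inner one is q.  The values at
   N <= 0 other than N = -1, 0 are irrelevant.  The bounds 2 N on m and N^2 on n
   lose nothing, see [d_coef]. *)
Definition d (N : int) : {poly {poly int}} :=
  if (1 <= N)%R then
    \poly_(m < (2 * `|N|).+1) \poly_(n < (`|N| * `|N|).+1) (D `|N| m n)%:Z
  else 1.

Definition p (n : nat) : {poly {poly int}} :=
  \prod_(1 <= i < n.+1)
    (1 + ('X^(2 * i - 1))%:P * 'X + ('X^(4 * i - 2))%:P * 'X^2).

(* Coefficient of x^i in the formal power series f / g, for g(0) = 1, obtained
   from 1 / g = \sum_k (1 - g)^k; characterised by [fps_divP]. *)
Definition fps_div (R : comNzRingType) (f g : {poly R}) (i : nat) : R :=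
  (f * \sum_(k < i.+1) (1 - g) ^+ k)`_i.

Definition chi_o (n : int) : int := (odd `|n|)%:Z.

Definition e (n : int) : int :=
  Num.ceil ((n + 3 * chi_o n)%:~R / 6 : rat) - chi_o n.

(* For n >= -1 one has 0 <= e n ([e_ge0]), so the absolute value is only a cast
   to nat. *)
Definition ctilde (n : int) (i : nat) : {poly int} :=
  fps_div (d n) (p `|e n|%N) i.

(* c(n, i) = 0 for i < 0 and for i > n, by convention. *)
Definition c (n : nat) (i : int) : {poly int} :=
  if (0 <= i <= n%:Z)%R then fps_div (d (6 * n%:Z - 1)) (p n) `|i|%N else 0.

(* Z[q, q^-1] is viewed as a subring of the fraction field of Z[q]: laurent is
   the inclusion of Z[q] (injective by [tofrac_eq]) and q is invertible, so that
   q ^ k makes sense for k : int. *)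
Definition laurent (a : {poly int}) : {fraction {poly int}} := tofrac a.

Definition q : {fraction {poly int}} := laurent 'X.

Lemma fps_divP (R : comNzRingType) (f g : {poly R}) (a : nat -> R) :
  g`_0 = 1 ->
  (forall i, \sum_(k < i.+1) g`_k * a (i - k)%N = f`_i) <-> a =1 fps_div f g.
Proof.
move=> g0.
have val1 k i : (i < k)%N -> ((1 - g) ^+ k)`_i = 0.
  elim: k i => // k IH i lt_ik; rewrite exprS coefM big1 // => -[[|j] ltj] _ /=.
    by rewrite coefB coef1 g0 subrr mul0r.
  by rewrite IH ?mulr0 //; case: i lt_ik ltj => // i; rewrite subSS !ltnS => h _;
     apply: leq_ltn_trans (leq_subr _ _) _.
have uptrunc h i m : (i <= m)%N ->
    (h * \sum_(k < m.+1) (1 - g) ^+ k)`_i = fps_div h g i.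
  rewrite /fps_div; move=> /subnK <-; elim: (m - i)%N => // t IH.
  rewrite addSn big_ord_recr /= mulrDr coefD IH.
  rewrite [X in _ + X]coefM [X in _ + X]big1 ?addr0 // => j _; rewrite val1 ?mulr0 //.
  by rewrite ltnS (leq_trans (leq_subr _ _)) ?leq_addl.
have sol i : \sum_(k < i.+1) g`_k * fps_div f g (i - k)%N = f`_i.
  under eq_bigr => k _ do rewrite -(uptrunc f (i - k)%N i (leq_subr _ _)).
  rewrite -coefM mulrCA.
  have -> : g * (\sum_(k < i.+1) (1 - g) ^+ k) = 1 - (1 - g) ^+ i.+1.
    by rewrite -[RHS]opprB subrX1 -mulNr opprB subKr.
  rewrite mulrBr mulr1 coefB [X in _ - X]coefM [X in _ - X]big1 ?subr0 // => j _.
  by rewrite val1 ?mulr0 // ltnS leq_subr.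
split=> [Ha i | Ha i]; last by rewrite -sol; apply: eq_bigr => k _; rewrite Ha.
elim/ltn_ind: i => i IH.
have := sol i; rewrite -Ha !big_ord_recl /= g0 !mul1r subn0.
under [in RHS]eq_bigr => k _.
  rewrite IH; first over.
  by rewrite /bump /=; have := ltn_ord k; lia.
by move/addIr.
Qed.

Lemma p0 n : (p n)`_0 = 1.
Proof.
rewrite -horner_coef0 /p horner_prod big1 // => i _.
by rewrite !hornerE /= !mulr0 addr0.
Qed.

Lemma schur_bound (N n : nat) (s : seq nat) :
  is_partition n s -> is_schur s -> all (geq N) s ->
  (weight s <= 2 * N)%N /\ (n <= N * N)%N.
Proof.
case/and3P=> _ pos /eqP <- /andP[dist _] /allP le_sN.
have us : uniq s.
  by rewrite uniq_pairwise; apply: sub_pairwise dist => a b /=;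
     apply: contraTneq => ->; rewrite subnn.
have sz : (size s <= N)%N.
  rewrite -[leqRHS](size_iota 1); apply: uniq_leq_size => // a a_s.
  by rewrite mem_iota add1n ltnS (allP pos _ a_s); apply: le_sN.
split.
  by rewrite /weight mul2n -addnn leq_add // (leq_trans (count_size _ _)).
apply: leq_trans (leq_mul sz (leqnn N)).
elim: s {us sz pos dist} le_sN => //= a s IH le_sN.
rewrite mulSn leq_add //; first by apply: le_sN; rewrite mem_head.
by apply: IH => b b_s; apply: le_sN; rewrite inE b_s orbT.
Qed.

Lemma d_coef (N m n : nat) :
  (1 <= N)%N -> (d N%:Z)`_m`_n = (D N m n)%:Z.
Proof.
move=> N1; rewrite /d lez_nat N1 absz_nat coef_poly.
have D0 : (D N m n != 0)%N -> (m < (2 * N).+1)%N /\ (n < (N * N).+1)%N.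
  rewrite -lt0n => /card_gt0P[s]; rewrite inE => /and3P[ps ss /eqP <-].
  rewrite !ltnS; apply: (schur_bound ps ss); apply/allP => a /mapP[i _ ->].
  by rewrite /= -ltnS.
case: (eqVneq (D N m n) 0%N) => [z|/D0[-> lt_n]]; last by rewrite coef_poly lt_n.
by case: ifP => _; rewrite ?coef0 ?coef_poly z // if_same.
Qed.

Lemma e_ge0 (n : int) : -1 <= n -> 0 <= e n.
Proof.
move=> n1; rewrite /e subr_ge0 /chi_o.
case: (boolP (odd `|n|)) => [on|en] /=; last first.
  rewrite mulr0 addr0 ceil_ge0.
  have : (-1)%:~R <= n%:~R :> rat by rewrite ler_int.
  lra.
rewrite -gtz0_ge1 ceil_gt0 divr_gt0 // ltr0z; lia.
Qed.

(* Main.v *)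
Require Import Defs.
From mathcomp Require Import all_boot all_order all_algebra.
From mathcomp Require Import zify ring.
Import Order.TTheory GRing.Theory Num.Theory.
Local Open Scope ring_scope.

(** Removing the largest part of a Schur partition gives the recurrence
      d_N = d_(N-1) + x^(1 or 2) q^N d_M,
    where the exponent of x is 1 for N odd and 2 for N even, and M is N - 3,
    or N - 4 if 3 divides N, with d_M = 1 for M <= 0 ([d_rec]).  Reading it along one period of length 6
    expresses d_(6n+2), ..., d_(6n+7) linearly in d_(6n-1) and d_(6n+1)
    ([d_residues]).

    Let f' denote f with x replaced by x q^2.  The heart of the proof is the
    pair of identities ([d_dilation])
      d_(6n+2) = (1 + x q + x^2 q^2) d_(6n-1)'
      d_(6n+4) = (1 + x q + x^2 q^2) d_(6n+1)'.
    They propagate together from n to n + 1: by the recurrences, both sides of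
    the identities for n + 1 are combinations of d_(6n+2) and d_(6n+4), and the
    coefficients of these combinations agree.

    Since p_(n+1) = (1 + x q + x^2 q^2) p_n' ([p_recl]), the identities imply by
    induction that p_n divides d_(6n-1) and d_(6n+1).  Writing a_n and b_n for
    the quotients, one gets
      a_(n+1) = b_n' + x q^(6n+5) a_n'
    and a similar formula for b_(n+1), which bound the x-degrees of a_n and b_n
    by n and n + 1 ([quotients], [d_quotients], [size_quotients]).  The degree
    bound matters because c(n, i) is 0 by convention for i > n.  So c(n, i) is
    the coefficient of x^i in a_n.

    With n = N - 1, each of the six quotients of the theorem is a combination
    of a_n, a_n', b_n and a_(n+1) ([ctilde_quotients]).  Two of them involve
    b_n; the formula for a_(n+1), read coefficientwise and multiplied by
    q^(-2j), eliminates b_n and produces the negative powers of q. *)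

(** * Recurrence from the largest part *)

(** Grouped by largest part.  The truncated subtraction returns the list for 0,
    holding only the empty partition, whenever the largest part leaves no room
    for another one. *)
Fixpoint schur_list (N : nat) : seq (seq nat) :=
  if N is M.+1 then
    schur_list M ++ [seq M.+1 :: t | t <- schur_list (M - (if 3 %| M.+1 then 3 else 2))%N]
  else [:: [::]].

(** Nonincreasing order is not recorded: parts that differ by at least 3, as
    truncated differences along the sequence, already decrease. *)
Definition bounded_schur (N : nat) (s : seq nat) : bool :=
  [&& is_schur s, all (leq 1) s & all (geq N) s].

Lemma bounded_schur0 s : bounded_schur 0 s = (s == [::]).
Proof.
by case: s => // -[|a] s; rewrite /bounded_schur /= ?andbF.
Qed.

(** A part N = M + 1 forces the others to be at most N - 3, and this settles the
    distance condition.  The value N - 3 itself is forbidden exactly when it is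
    the preceding multiple of 3. *)
Lemma bounded_schur_cons M t :
  bounded_schur M.+1 (M.+1 :: t)
  = bounded_schur (M - (if 3 %| M.+1 then 3 else 2))%N t.
Proof.
apply/idP/idP.
  case/and3P=> /andP[/= /andP[far pw] /andP[_ /allP no3]] pos le.
  have posP b : b \in t -> (1 <= b)%N by move=> bt; exact: (allP pos).
  apply/and3P; split=> //.
    rewrite /is_schur pw; apply/allP=> a at_; apply/implyP=> d3.
    by have := no3 a at_; rewrite d3 inE negb_or => /andP[].
  apply/allP=> b bt /=.
  have /= b1 := posP b bt.
  have := allP far b bt; have := no3 b bt; rewrite inE /=.
  case: ifP => d3 h; last by lia.
  by move=> h'; case: (eqVneq (b + 3)%N M.+1) h => [eb|ne] /=; [have -> : (3 %| b)%N by lia | lia].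
case/and3P=> /andP[pw /allP no3] pos /allP le.
have posP b : b \in t -> (1 <= b)%N by move=> bt; exact: (allP pos).
have far b : b \in t -> (b + 3 <= M.+1)%N /\ ((3 %| M.+1)%N -> (b + 4 <= M.+1)%N).
  move=> bt; have := le b bt; have := posP b bt; rewrite /=.
  by case: ifP => d3; lia.
apply/and3P; split.
- rewrite /is_schur /= pw andbT; apply/and3P; split.
  + by apply/allP=> b /far[]; lia.
  + apply/implyP=> _; rewrite inE negb_or; apply/andP; split; first by lia.
    by apply/negP => /far[]; lia.
  + apply/allP=> b bt; apply/implyP=> d3; rewrite inE negb_or.
    have := no3 b bt; rewrite d3 /= => ->; rewrite andbT.
    by have [h1 h2] := far b bt; apply/eqP => eM; lia.
- exact: pos.
- by apply/allP=> b; rewrite inE => /predU1P[->|/far[]] /=; lia.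
Qed.

Lemma mem_schur_list N s : (s \in schur_list N) = bounded_schur N s.
Proof.
elim/ltn_ind: N s => -[_|M IH] s; first by rewrite inE bounded_schur0.
rewrite mem_cat IH //; apply/orP/idP.
  case=> [/and3P[sS pos le]|/mapP[t]].
    by apply/and3P; split=> //; apply: sub_all le => a /=; lia.
  by rewrite IH ?ltnS ?leq_subr // => tS ->; rewrite bounded_schur_cons.
case: s => [|a t] sS; first by left.
case: (eqVneq a M.+1) sS => [->|ne] sS.
  right; apply: map_f; rewrite IH ?ltnS ?leq_subr //.
  by rewrite -bounded_schur_cons.
left; case/and3P: sS => sS pos /= /andP[aM le]; apply/and3P; split=> //=.
rewrite (_ : (a <= M)%N) /=; last by lia.
case/andP: sS => /= /andP[/allP far _] _.
by apply/allP=> b /far /=; lia.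
Qed.

Lemma schur_list_uniq N : uniq (schur_list N).
Proof.
elim/ltn_ind: N => -[_|M IH] //=.
rewrite cat_uniq IH // map_inj_uniq ?IH ?ltnS ?leq_subr // ?andbT; last by move=> ? ? [].
apply/hasPn=> _ /mapP[t _ ->]; rewrite mem_schur_list.
by apply/negP=> /and3P[_ _] /=; rewrite ltnn.
Qed.

(** The bounded sequences counted by D and the listed partitions of n correspond
    by forgetting the bounds: a partition of n has at most n positive parts. *)
Lemma D_count N m n :
  D N m n = count (fun s => (weight s == m) && (sumn s == n)) (schur_list N).
Proof.
rewrite /D cardE -size_filter.
pose forget (s : n.-bseq 'I_N.+1) := map val s.
rewrite -(size_map forget); apply/perm_size/uniq_perm.
- rewrite map_inj_uniq ?enum_uniq // => s t /(inj_map val_inj); exact: val_inj.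
- by rewrite filter_uniq ?schur_list_uniq.
move=> s; rewrite mem_filter mem_schur_list; apply/mapP/idP.
  case=> t; rewrite mem_enum inE => /and3P[/and3P[_ pos /eqP sz] sS wt] ->.
  rewrite -/(forget t) in pos sz sS wt *.
  rewrite wt sz eqxx /=; apply/and3P; split=> //.
  by apply/allP=> _ /mapP[i _ ->]; rewrite /= -ltnS.
case/andP=> /andP[wt /eqP sz] /and3P[sS pos /allP le].
have sN : [seq val i | i <- [seq inord i : 'I_N.+1 | i <- s]] = s.
  rewrite -map_comp -[RHS]map_id; apply/eq_in_map=> a /le /= aN.
  by rewrite inordK.
have szn : (size [seq inord i : 'I_N.+1 | i <- s] <= n)%N.
  rewrite size_map -sz; elim: s pos {wt sz sS le sN} => //= a s IH /andP[a1 /IH]; lia.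
exists (Bseq szn); rewrite /forget /= ?sN // mem_enum inE /= sN wt sS andbT /=.
rewrite /is_partition sz pos eqxx !andbT.
apply: pairwise_sorted; case/andP: sS => pw _.
by apply: sub_pairwise pw => a b /=; rewrite /geq /=; lia.
Qed.

Definition monomial (s : seq nat) : {poly {poly int}} :=
  ('X%:P) ^+ sumn s * 'X ^+ weight s.

Lemma d_sum (N : nat) : d N%:Z = \sum_(s <- schur_list N) monomial s.
Proof.
case: N => [|N].
  by rewrite /d /= big_seq1 /monomial /weight /= !expr0 mulr1.
apply/polyP=> m; apply/polyP=> n; rewrite d_coef // D_count.
rewrite !coef_sum -sum1_count (big_morph Posz PoszD (erefl _)) big_mkcond /=.
apply: eq_bigr => s _; rewrite /monomial -polyC_exp coefCM coefXn.
rewrite [weight s == m]eq_sym [sumn s == n]eq_sym.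
case: (m == weight s) => /=; last by rewrite mulr0 coef0.
by rewrite mulr1 coefXn; case: (n == sumn s).
Qed.

Lemma d_rec (N : nat) :
  d N.+1%:Z = d N%:Z
    + 'X%:P ^+ N.+1 * 'X ^+ (if odd N.+1 then 1 else 2)
      * d (N - (if 3 %| N.+1 then 3 else 2))%N%:Z.
Proof.
rewrite !d_sum [schur_list N.+1]/= big_cat big_map /=; congr (_ + _).
rewrite big_distrr /=; apply: eq_bigr => t _.
rewrite /monomial /weight /= exprD.
by case: (odd N); rewrite ?addnS ?addSn /= ?exprS; ring.
Qed.

(** * The dilation x -> x q^2 *)

Local Notation qx := ('X%:P : {poly {poly int}}).
Local Notation dilate f := (f \Po (qx ^+ 2 * 'X)).

Lemma coef_dilate (f : {poly {poly int}}) i :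
  (dilate f)`_i = 'X^(2 * i) * f`_i.
Proof.
rewrite -polyC_exp.
elim/poly_ind: f i => [|f a IH] i; first by rewrite comp_poly0 coef0 mulr0.
rewrite comp_polyD comp_polyM comp_polyX comp_polyC.
rewrite mulrCA coefD coefCM coefMX coefC coefD coefMX coefC.
case: i => [|i] /=; first by rewrite mulr0 muln0 expr0 mul1r.
by rewrite !addr0 IH mulrA -exprD mulnS.
Qed.

Lemma dilateXn (f : {poly {poly int}}) k : dilate (f ^+ k) = (dilate f) ^+ k.
Proof. exact: rmorphXn. Qed.

Lemma dilate1 : dilate 1 = 1.
Proof. exact: rmorph1. Qed.

Definition dilateE :=
  (dilate1, dilateXn, comp_polyD, comp_polyM, comp_polyC, comp_polyX).

Lemma p_recl n : p n.+1 = (1 + qx * 'X + qx ^+ 2 * 'X ^+ 2) * dilate (p n).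
Proof.
rewrite /p big_nat_recl //=; congr (_ * _); first by rewrite -polyC_exp.
rewrite rmorph_prod /=; apply: eq_big_nat => i /andP[i1 _].
have shift k j l : l = (k + j)%N -> ('X^l)%:P = ('X^k)%:P * qx ^+ j.
  by move=> ->; rewrite -polyC_exp -polyCM -exprD.
rewrite (shift (2 * i - 1)%N 2%N (2 * i.+1 - 1)%N); last by lia.
rewrite (shift (4 * i - 2)%N 4%N (4 * i.+1 - 2)%N); last by lia.
by rewrite !dilateE; ring.
Qed.

(** For n = 0 the truncated 6 * n - 1 is 0; this agrees with the convention
    d_(-1) = d_0 = 1. *)
Lemma d_residues n (A := d (6 * n - 1)%N%:Z) (C := d (6 * n + 1)%N%:Z)
    (F := d (6 * n + 2)%N%:Z) (G := d (6 * n + 4)%N%:Z) :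
  [/\ F = C + qx ^+ (6 * n + 2) * 'X ^+ 2 * A,
      d (6 * n + 3)%N%:Z = F + qx ^+ (6 * n + 3) * 'X * A,
      G = d (6 * n + 3)%N%:Z + qx ^+ (6 * n + 4) * 'X ^+ 2 * C,
      d (6 * n + 5)%N%:Z = G + qx ^+ (6 * n + 5) * 'X * F
    & d (6 * n + 6)%N%:Z = d (6 * n + 5)%N%:Z + qx ^+ (6 * n + 6) * 'X ^+ 2 * F
      /\ d (6 * n + 7)%N%:Z = d (6 * n + 6)%N%:Z + qx ^+ (6 * n + 7) * 'X * G].
Proof.
have step r :
  d (6 * n + r.+1)%N%:Z = d (6 * n + r)%N%:Z + qx ^+ (6 * n + r.+1)
   * 'X ^+ (if odd r.+1 then 1 else 2)
   * d (6 * n + r - (if 3 %| r.+1 then 3 else 2))%N%:Z.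
  rewrite addnS d_rec /= oddD oddM /=.
  by rewrite -addnS dvdn_addr // dvdn_mulr.
split; last split.
- by rewrite /F (step 1%N); congr (_ + _ * d _%:Z); rewrite /=; lia.
- by rewrite (step 2%N); congr (_ + _ * d _%:Z); rewrite /=; lia.
- by rewrite /G (step 3%N); congr (_ + _ * d _%:Z); rewrite /=; lia.
- by rewrite (step 4%N); congr (_ + _ * d _%:Z); rewrite /=; lia.
- by rewrite (step 5%N); congr (_ + _ * d _%:Z); rewrite /=; lia.
- by rewrite (step 6%N); congr (_ + _ * d _%:Z); rewrite /=; lia.
Qed.

(** With F = d_(6n+2) and G = d_(6n+4), the recurrences of one period express
    d_(6n+8) and d_(6n+10) linearly in F and G.  The induction hypotheses turn
    the dilated recurrences for d_(6n+5)' and d_(6n+7)', multiplied by p1, into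
    linear expressions in F and G as well, and the two coincide. *)
Lemma d_dilation n :
  let p1 := 1 + qx * 'X + qx ^+ 2 * 'X ^+ 2 in
  d (6 * n + 2)%N%:Z = p1 * dilate (d (6 * n - 1)%N%:Z)
  /\ d (6 * n + 4)%N%:Z = p1 * dilate (d (6 * n + 1)%N%:Z).
Proof.
move=> p1; elim: n => [|n [IHF IHG]].
  have [eF e3 eG _ _] := d_residues 0.
  have e0 : d 0%N%:Z = 1 by [].
  have e1 : d 1%N%:Z = 1 + qx * 'X by rewrite d_rec /= e0 mulr1.
  rewrite eG e3 eF /= e0 e1 /p1.
  rewrite !dilateE.
  by split; ring.
have [eF e3 eG eA [e6 eC]] := d_residues n.
have [eF' e3' eG' _ _] := d_residues n.+1.
have i5 : (6 * n.+1 - 1 = 6 * n + 5)%N by lia.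
have i7 : (6 * n.+1 + 1 = 6 * n + 7)%N by lia.
rewrite i5 i7 in eF' e3' eG' *.
rewrite eG' e3' eF' eC e6 eA.
move: IHF IHG eF e3 eG.
move: (d (6 * n - 1)%N%:Z) (d (6 * n + 1)%N%:Z) (d (6 * n + 3)%N%:Z) => A C E.
move: (d (6 * n + 2)%N%:Z) (d (6 * n + 4)%N%:Z) => F G IHF IHG eF e3 eG.
rewrite !dilateE.
have hF : dilate F = dilate C + qx ^+ (6 * n + 2) * (qx ^+ 2 * 'X) ^+ 2 * dilate A.
  by rewrite eF !dilateE.
have hG : dilate G = dilate F + qx ^+ (6 * n + 3) * (qx ^+ 2 * 'X) * dilate A
    + qx ^+ (6 * n + 4) * (qx ^+ 2 * 'X) ^+ 2 * dilate C.
  by rewrite eG e3 !dilateE.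
rewrite mulnS.
(* The induction hypotheses replace p1 * A' and p1 * C' by F and G. *)
have {}hF : p1 * dilate F = G + qx ^+ (6 * n + 2) * (qx ^+ 2 * 'X) ^+ 2 * F.
  by rewrite hF IHF IHG; ring.
have {}hG : p1 * dilate G = p1 * dilate F + qx ^+ (6 * n + 3) * (qx ^+ 2 * 'X) * F
    + qx ^+ (6 * n + 4) * (qx ^+ 2 * 'X) ^+ 2 * G.
  by rewrite hG IHF IHG; ring.
split.
  transitivity (p1 * dilate G + qx ^+ (6 * n + 5) * (qx ^+ 2 * 'X) * (p1 * dilate F));
    last by ring.
  by rewrite hG hF !exprD; ring.
transitivity (p1 * dilate G + qx ^+ (6 * n + 5) * (qx ^+ 2 * 'X) * (p1 * dilate F)
  + qx ^+ (6 * n + 6) * (qx ^+ 2 * 'X) ^+ 2 * (p1 * dilate F)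
  + qx ^+ (6 * n + 7) * (qx ^+ 2 * 'X) * (p1 * dilate G)); last by ring.
by rewrite hG hF !exprD; ring.
Qed.

(** The pair (d_(6n-1) / p_n, d_(6n+1) / p_n), computed without division: these
    are the recurrences for d_(6n+5) and d_(6n+7) after the identities of
    [d_dilation] and cancellation of p_(n+1). *)
Fixpoint quotients (n : nat) : {poly {poly int}} * {poly {poly int}} :=
  if n is m.+1 then
    let a := dilate (quotients m).1 in
    let b := dilate (quotients m).2 in
    (b + ('X^(6 * m + 5))%:P * (a * 'X),
     b + ('X^(6 * m + 7))%:P * (b * 'X) + ('X^(6 * m + 5))%:P * (a * 'X)
       + ('X^(6 * m + 6))%:P * (a * 'X^2))
  else (1, 1 + qx * 'X).

Lemma d_quotients n :
  d (6 * n - 1)%N%:Z = p n * (quotients n).1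
  /\ d (6 * n + 1)%N%:Z = p n * (quotients n).2.
Proof.
elim: n => [|n [IHa IHb]].
  by rewrite /p big_geq // !mul1r; split=> //; rewrite d_rec /= mulr1.
have [_ _ _ eA [e6 eC]] := d_residues n.
have [eF eG] := d_dilation n.
rewrite (_ : 6 * n.+1 - 1 = 6 * n + 5)%N; last by lia.
rewrite (_ : 6 * n.+1 + 1 = 6 * n + 7)%N; last by lia.
rewrite eC e6 eA eF eG IHa IHb p_recl /= !comp_polyM !polyC_exp.
by split; ring.
Qed.

Lemma size_quotients n :
  (size (quotients n).1 <= n.+1)%N /\ (size (quotients n).2 <= n.+2)%N.
Proof.
elim: n => [|n [/leq_sizeP IHa /leq_sizeP IHb]] /=.
  split; first by rewrite size_poly1.
  apply/leq_sizeP=> -[|[|i]] // _.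
  by rewrite coefD coef1 coefCM coefX mulr0 addr0.
split; apply/leq_sizeP=> i le_i.
  rewrite coefD coefCM coefMX !coef_dilate IHb // (_ : i == 0%N = false); last by lia.
  by rewrite IHa ?mulr0 ?addr0 //; lia.
rewrite !coefD !coefCM !coefMX coefMXn !coef_dilate (_ : i == 0%N = false); last by lia.
rewrite (_ : (i < 2)%N = false); last by lia.
by rewrite !IHb ?IHa ?mulr0 ?addr0 //; lia.
Qed.

(** * Coefficients *)

Lemma fps_div_exact (R : comNzRingType) (g h : {poly R}) i :
  g`_0 = 1 -> fps_div (g * h) g i = h`_i.
Proof.
move=> g0; symmetry; move: i; apply/(fps_divP (g * h) _ g0) => i.
by rewrite coefM.
Qed.

(** For i > n the left-hand side vanishes by convention and the right-hand side
    because the quotient has degree at most n. *)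
Lemma c_quotient (n : nat) (i : nat) : c n i%:Z = (quotients n).1`_i.
Proof.
rewrite /c; have -> : d (6 * n%:Z - 1) = d (6 * n - 1)%N%:Z.
  by case: n => // n; congr d; lia.
case: ifP => h; first by rewrite (d_quotients n).1 fps_div_exact ?p0.
by rewrite nth_default //; apply: leq_trans (size_quotients n).1 _; lia.
Qed.

Lemma c_neg n i : i < 0 -> c n i = 0.
Proof. by rewrite /c leNgt => ->. Qed.

Lemma e_residues (n : nat) :
  [/\ e (6 * n.+1%:Z) = n.+1%:Z, e (6 * n.+1%:Z - 1) = n.+1%:Z,
      e (6 * n.+1%:Z - 2) = n.+1%:Z, e (6 * n.+1%:Z - 3) = n%:Z
    & e (6 * n.+1%:Z - 4) = n.+1%:Z /\ e (6 * n.+1%:Z - 5) = n%:Z].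
Proof.
have ceil6 (m k r : int) : 0 <= r < 6 -> m = 6 * k - r ->
    Num.ceil (m%:~R / 6 : rat) = k.
  move=> /andP[r0 r6] ->; apply: ceil_def; rewrite ltr_pdivlMr // ler_pdivrMr //.
  rewrite -[6 : rat]/(6%:~R) -!intrM ltr_int ler_int; lia.
rewrite /e /chi_o; split; last split.
- by rewrite (ceil6 _ n.+1%:Z 0); lia.
- by rewrite (ceil6 _ n.+2%:Z 4); lia.
- by rewrite (ceil6 _ n.+1%:Z 2); lia.
- by rewrite (ceil6 _ n.+1%:Z 0); lia.
- by rewrite (ceil6 _ n.+1%:Z 4); lia.
- by rewrite (ceil6 _ n.+1%:Z 2); lia.
Qed.

(** Each d_m below is a multiple of p_(e(m)) by an explicit polynomial.  For
    m = 6N - 2 the recurrence is used backwards, d_(6n+4) being the difference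
    of d_(6n+5) and x q^(6n+5) d_(6n+2). *)
Lemma ctilde_quotients (n j : nat)
    (a := (quotients n).1) (b := (quotients n).2) (a' := (quotients n.+1).1) :
  [/\ ctilde (6 * n.+1%:Z) j = a'`_j + 'X^(6 * n + 6) * (dilate a * 'X^2)`_j,
      ctilde (6 * n.+1%:Z - 1) j = a'`_j,
      ctilde (6 * n.+1%:Z - 2) j = a'`_j - 'X^(6 * n + 5) * (dilate a * 'X^1)`_j,
      ctilde (6 * n.+1%:Z - 3) j
        = b`_j + 'X^(6 * n + 2) * (a * 'X^2)`_j + 'X^(6 * n + 3) * (a * 'X^1)`_j
    & ctilde (6 * n.+1%:Z - 4) j = (dilate a)`_j
      /\ ctilde (6 * n.+1%:Z - 5) j = b`_j].
Proof.
have [E0 E1 E2 E3 [E4 E5]] := e_residues n.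
have [eF e3 eG eA [e6 eC]] := d_residues n.
have [dF dG] := d_dilation n.
have [dA dC] := d_quotients n.
have [dA' _] := d_quotients n.+1.
rewrite (_ : 6 * n.+1 - 1 = 6 * n + 5)%N in dA'; last by lia.
have ctildeE m k l h :
    m = k%:Z -> e m = l%:Z -> d k%:Z = p l * h -> ctilde m j = h`_j.
  by move=> -> el dk; rewrite /ctilde el absz_nat dk fps_div_exact ?p0.
have pF : d (6 * n + 2)%N%:Z = p n.+1 * dilate a.
  by rewrite dF dA p_recl comp_polyM mulrA.
rewrite -!coefCM -coefB -!coefD; split; last split.
- apply: (ctildeE _ (6 * n + 6)%N _ _ _ E0); first by lia.
  by rewrite e6 dA' pF polyC_exp; ring.
- by apply: (ctildeE _ (6 * n + 5)%N _ _ _ E1); first by lia.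
- apply: (ctildeE _ (6 * n + 4)%N _ _ _ E2); first by lia.
  have -> : d (6 * n + 4)%N%:Z
      = d (6 * n + 5)%N%:Z - qx ^+ (6 * n + 5) * 'X * d (6 * n + 2)%N%:Z.
    by rewrite eA addrK.
  by rewrite dA' pF polyC_exp; ring.
- apply: (ctildeE _ (6 * n + 3)%N _ _ _ E3); first by lia.
  by rewrite e3 eF dA dC !polyC_exp; ring.
- by apply: (ctildeE _ (6 * n + 2)%N _ _ _ E4); first by lia.
- by apply: (ctildeE _ (6 * n + 1)%N _ _ _ E5); first by lia.
Qed.

Lemma q_neq0 : q != 0.
Proof. by rewrite /q /laurent tofrac_eq0 polyX_eq0. Qed.

Lemma laurentD x y : laurent (x + y) = laurent x + laurent y.
Proof. exact: rmorphD. Qed.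

Lemma laurentB x y : laurent (x - y) = laurent x - laurent y.
Proof. exact: rmorphB. Qed.

Lemma laurentM x y : laurent (x * y) = laurent x * laurent y.
Proof. exact: rmorphM. Qed.

Lemma laurentXn k : laurent 'X^k = q ^ k%:Z.
Proof. by rewrite /laurent rmorphXn. Qed.

Lemma coef_quotient_shift (n j k : nat) :
  ((quotients n).1 * 'X^k)`_j = c n (j%:Z - k%:Z).
Proof.
rewrite coefMXn; case: ltnP => jk; first by rewrite c_neg //; lia.
by rewrite subzn // c_quotient.
Qed.

Lemma laurent_dilate_shift (n j k : nat) :
  laurent (dilate (quotients n).1 * 'X^k)`_j
  = laurent (c n (j%:Z - k%:Z)) * q ^ (2 * (j%:Z - k%:Z)).
Proof.
rewrite -coef_quotient_shift !coefMXn; case: ltnP => jk; first by rewrite [laurent 0]rmorph0 mul0r.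
by rewrite coef_dilate laurentM laurentXn mulrC PoszM subzn.
Qed.

Theorem theorem3 (N j : nat) (hN : (1 <= N)%N) :
  [/\ laurent (ctilde (6 * N%:Z) j)
        = laurent (c N j%:Z)
          + q ^ (6 * N%:Z) * laurent (c (N - 1)%N (j%:Z - 2)) * q ^ (2 * (j%:Z - 2)),
      laurent (ctilde (6 * N%:Z - 1) j) = laurent (c N j%:Z),
      laurent (ctilde (6 * N%:Z - 2) j)
        = laurent (c N j%:Z)
          - q ^ (6 * N%:Z - 1) * laurent (c (N - 1)%N (j%:Z - 1)) * q ^ (2 * (j%:Z - 1)),
      laurent (ctilde (6 * N%:Z - 3) j)
        = q ^ (- (2 * j%:Z)) * laurent (c N j%:Z)
          + q ^ (6 * N%:Z - 4) * laurent (c (N - 1)%N (j%:Z - 2))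
    & laurent (ctilde (6 * N%:Z - 4) j) = laurent (c (N - 1)%N j%:Z) * q ^ (2 * j%:Z)
      /\ laurent (ctilde (6 * N%:Z - 5) j)
        = q ^ (- (2 * j%:Z)) * laurent (c N j%:Z)
          - q ^ (6 * N%:Z - 3) * laurent (c (N - 1)%N (j%:Z - 1))].
Proof.
case: N hN => // n _; rewrite subn1 /=.
have [-> -> -> -> [-> ->]] := ctilde_quotients n j.
have qD := expfzDr _ _ q_neq0.
(* The recurrence for the first quotient at n + 1, solved for the second one at
   n: its x^j coefficient carries q^(2j), hence the negative power. *)
have lb : laurent (quotients n).2`_j = q ^ (- (2 * j%:Z)) * laurent (c n.+1 j%:Z)
    - q ^ (6 * n.+1%:Z - 3) * laurent (c n (j%:Z - 1)).
  rewrite c_quotient /= coefD coefCM coef_dilate.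
  have := laurent_dilate_shift n j 1; rewrite expr1 => dil1.
  rewrite laurentD !laurentM !laurentXn dil1 mulrDr !mulrA -qD.
  rewrite (_ : - _ + _ = 0); last by lia.
  rewrite expr0z mul1r [_ * laurent (c _ _) * _]mulrAC -!qD.
  by rewrite (_ : _ + _ + _ = 6 * n.+1%:Z - 3) ?addrK; last by lia.
rewrite !(laurentB, laurentD, laurentM) lb !laurent_dilate_shift !coef_quotient_shift !laurentXn.
rewrite !c_quotient.
split; last split.
- by rewrite mulrA; congr (_ + q ^ _ * _ * _); lia.
- by [].
- by rewrite mulrA; congr (_ - q ^ _ * _ * _); lia.
- rewrite (_ : (6 * n + 3)%N%:Z = 6 * n.+1%:Z - 3); last by lia.
  rewrite (_ : (6 * n + 2)%N%:Z = 6 * n.+1%:Z - 4); last by lia.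
  by rewrite addrAC subrK.
- by rewrite coef_dilate laurentM laurentXn mulrC PoszM.
- by [].
Qed.
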